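(* Let $A=U+XY^H\in\mathbb{C}^{n\times n}$ be a nonsingular proper upper Hessenberg matrix with $U$ unitary and $X,Y\in\mathbb{C}^{n\times k}$ of full rank, let $\hat A\in\mathbb{C}^{N\times N}$, $N=n+k$, be its embedding, and assume that the QR iteration applied to $\hat A$ is convergent to an upper triangular matrix. Denote by $\hat A^{(s)}=L^{(s)}(Q^{(s)}+TZ^{(s)H})R^{(s)}$ the matrix obtained after $s$ steps of the QR algorithm, by $q^{(s)}_{ij}$ the entries of $Q^{(s)}$, and by $a^{(s)}_{ij}$ the entries of the leading $n\times n$ principal submatrix $A^{(s)}$ of $\hat A^{(s)}$. Let $K=1/\prod_{i=1}^k\sigma_i(\hat X)$. Then, for $i=1,\dots,n-1$, $$\lim_{s\to\infty}q^{(s)}_{i+k+1,i+k}=0,$$ and moreover, for any prescribed tolerance $\tau>0$, if $s$ is such that $|q^{(s)}_{i+k+1,i+k}|<\tau K$, then $|a^{(s)}_{i+1,i}|<\tau$.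
   Context: A matrix $H$ is $k$-upper Hessenberg if $h_{ij}=0$ whenever $i>j+k$, and $k$-lower Hessenberg if $h_{ij}=0$ whenever $j>i+k$; ''upper Hessenberg'' means $1$-upper Hessenberg. A $k$-upper (resp. $k$-lower) Hessenberg matrix of size $m$ is proper if $h_{j+k,j}\ne 0$ (resp. $h_{j,j+k}\neq 0$) for $1\le j\le m-k$. $\sigma_i(\cdot)$ are singular values. Embedding. Take an economy-size QR decomposition $Y=Q_YR_Y$ ($Q_Y\in\mathbb{C}^{n\times k}$ with orthonormal columns, $R_Y\in\mathbb{C}^{k\times k}$ upper triangular), set $\tilde Y=Q_Y$, $\tilde X=XR_Y^H$, $B=U\tilde Y$, and define $$\hat U=\begin{bmatrix}U-U\tilde Y\tilde Y^H & B\\ \tilde Y^H & 0_k\end{bmatrix},\quad \hat X=\begin{bmatrix}\tilde X+B\\ -I_k\end{bmatrix},\quad \hat Y=\begin{bmatrix}\tilde Y\\ 0_k\end{bmatrix},\quad \hat A=\hat U+\hat X\hat Y^H=\begin{bmatrix}A & B\\ 0_{k,n}&0_k\end{bmatrix}.$$ Here $\hat U$ is unitary. QR iterates and their representation. After $s$ steps of the QR algorithm, $\hat A^{(s)}=P_s^H\hat AP_s$ is upper Hessenberg, where $P_s=\mathrm{diag}(P_{s,1},I_k)$ is the accumulated unitary matrix ($P_{s,1}\in\mathbb{C}^{n\times n}$). It is represented as $\hat A^{(s)}=L^{(s)}(Q^{(s)}+TZ^{(s)H})R^{(s)}$, where $L^{(s)}$ is proper unitary $k$-lower Hessenberg, $R^{(s)}$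 is proper unitary $k$-upper Hessenberg, $Q^{(s)}$ is a block diagonal unitary upper Hessenberg matrix with a $k\times k$ unitary diagonal leading block and an $n\times n$ unitary upper Hessenberg trailing block, $T=\begin{bmatrix}T_k\\0_{n,k}\end{bmatrix}$ with $T_k\in\mathbb{C}^{k\times k}$ nonsingular upper triangular, and $L^{(s)}T=P_s^H\hat X$, $L^{(s)}Q^{(s)}R^{(s)}=P_s^H\hat UP_s$, $Z^{(s)}=R^{(s)}P_s^H\hat Y$. *)

(* Defs.v *)
From HB Require Import structures.
From mathcomp Require Import all_boot all_order all_algebra.
From mathcomp Require Import complex.
From mathcomp Require Import boolp classical_sets reals topology normedtype.
Import Order.TTheory GRing.Theory Num.Theory numFieldNormedType.Exports.

Set Implicit Arguments.
Unset Strict Implicit.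
Unset Printing Implicit Defensive.

Local Open Scope classical_set_scope.
Local Open Scope ring_scope.
Local Open Scope complex_scope.
Local Open Scope sesquilinear_scope.

Section Shapes.
Variables (C : nzRingType) (m : nat).
Implicit Types (k : nat) (H : 'M[C]_m).

Definition upper_hessenberg k H := forall i j : 'I_m, (j + k < i)%N -> H i j = 0.

Definition lower_hessenberg k H := forall i j : 'I_m, (i + k < j)%N -> H i j = 0.

Definition proper_upper_hessenberg k H :=
  upper_hessenberg k H /\ forall i j : 'I_m, i = (j + k)%N :> nat -> H i j != 0.

Definition proper_lower_hessenberg k H :=
  lower_hessenberg k H /\ forall i j : 'I_m, j = (i + k)%N :> nat -> H i j != 0.

(* mathcomp's is_trig_mx means lower triangular *)
Definition upper_triangular H : bool := is_trig_mx H^T.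

End Shapes.

Section SingularValues.
Variables (R : realType) (m k : nat).
Implicit Type X : 'M[R[i]]_(m, k).

(* Square roots of the eigenvalues of X^H X (real and nonnegative), with       *)
(* multiplicity, in nonincreasing order. For k <= m these are the k singular   *)
(* values of X; for m < k the last k - m of them are padding zeros.            *)
Definition singular_values X : seq R :=
  sort >=%R [seq Num.sqrt (complex.Re (spectral_diag (X^t* *m X) 0 i)) | i : 'I_k].

(* 0-based: sigma X i is the (i+1)-st largest singular value *)
Definition sigma X (i : nat) : R := (singular_values X)`_i.

End SingularValues.

Section Embedding.
Variables (R : realType) (n k : nat).
Local Notation C := R[i].

(* Y = QY *m RY *)
Definition economy_qr (Y QY : 'M[C]_(n, k)) (RY : 'M[C]_k) :=
  [/\ QY^t* *m QY = 1%:M, upper_triangular RY & Y = QY *m RY].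

(* QY, RY are the economy-size QR factors of Y (so the embedded Y-tilde is QY, *)
(* X-tilde is X *m RY^t* and B is U *m QY).                                    *)
Variables (U : 'M[C]_n) (X QY : 'M[C]_(n, k)) (RY : 'M[C]_k).

Definition embedU : 'M[C]_(n + k) :=
  block_mx (U - U *m QY *m QY^t*) (U *m QY) (QY^t*) 0.

Definition embedX : 'M[C]_(n + k, k) :=
  col_mx (X *m RY^t* + U *m QY) (- 1%:M).

Definition embedY : 'M[C]_(n + k, k) := col_mx QY 0.

Definition embedA : 'M[C]_(n + k) := embedU + embedX *m embedY^t*.

Lemma embedAE (Y : 'M[C]_(n, k)) : economy_qr Y QY RY ->
  embedA = block_mx (U + X *m Y^t*) (U *m QY) 0 0.
Proof.
move=> [_ _ ->]; rewrite /embedA /embedU /embedX /embedY.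
rewrite tr_col_mx map_row_mx trmx0 map_mx0 mul_col_row !mulmx0 add_block_mx.
rewrite !addr0 mulNmx mul1mx subrr; congr block_mx.
by rewrite trmx_mul map_mxM mulmxDl mulmxA [X in _ + X]addrC addrA addrNK.
Qed.

End Embedding.

Section QRAlgorithm.
Variables (R : realType) (N : nat).
Local Notation C := R[i].
Implicit Types (A W : 'M[C]_N).

Definition shift_poly (rhos : seq C) A : 'M[C]_N :=
  foldr (fun rho M => (A - rho%:M) *m M) 1%:M rhos.

(* One QR step, with unitary factor W, for a shift polynomial with at least    *)
(* one root: a single shift, several simultaneous shifts, or, for the one      *)
(* shift 0, the unshifted step. The triangular factor is not normalized, so    *)
(* W is any unitary factor of a QR decomposition.                              *)
Definition qr_step A W A' :=
  exists (rhos : seq C) (T : 'M[C]_N),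
    [/\ rhos != [::], W \is unitarymx, upper_triangular T,
        shift_poly rhos A = W *m T & A' = W^t* *m A *m W].

(* As s is the iterate after s steps, P s the accumulated unitary matrix *)
Definition qr_iteration A (As P : nat -> 'M[C]_N) :=
  [/\ As 0%N = A, P 0%N = 1%:M &
      forall s, exists2 W, qr_step (As s) W (As s.+1) & P s.+1 = P s *m W].

Lemma qr_iterationE A As P : qr_iteration A As P ->
  forall s, P s \is unitarymx /\ As s = (P s)^t* *m A *m P s.
Proof.
move=> [A0 P0 step]; elim=> [|s [Pu Ps]].
  rewrite A0 P0 trmx1 map_mx1 mul1mx mulmx1; split=> //.
  by apply/unitarymxP; rewrite trmx1 map_mx1 mulmx1.
have [W [rhos [T [_ Wu _ _ ->]]] ->] := step s.
by split; [exact: mul_unitarymx | rewrite trmx_mul map_mxM Ps !mulmxA].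
Qed.

(* R[i]^o is R[i] with the topology of its modulus; matrices over it carry the *)
(* topology of entrywise convergence.                                          *)
Definition cvg_to_upper_triangular (As : nat -> 'M[C]_N) :=
  exists2 S : 'M[C]_N, upper_triangular S &
    (As : nat -> 'M[C^o]_N) @ \oo --> (S : 'M[C^o]_N).

End QRAlgorithm.

(* L (Q + T Z^H) Rs represents As = P^H (hU + hX hY^H) P. The size is written  *)
(* n + k as for the embedding, while Q and T are partitioned as k + n.         *)
Record represents (R : realType) (n k : nat)
    (hU : 'M[R[i]]_(n + k)) (hX hY : 'M[R[i]]_(n + k, k)) (P : 'M[R[i]]_(n + k))
    (Tk : 'M[R[i]]_k) (L Q Rs : 'M[R[i]]_(n + k)) (Z : 'M[R[i]]_(n + k, k))
    (As : 'M[R[i]]_(n + k)) : Prop := Represents {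
  rep_L : L \is unitarymx /\ proper_lower_hessenberg k L;
  rep_R : Rs \is unitarymx /\ proper_upper_hessenberg k Rs;
  rep_Q : upper_hessenberg 1 Q /\
    exists (Q1 : 'M[R[i]]_k) (Q2 : 'M[R[i]]_n),
      [/\ Q1 \is unitarymx, Q2 \is unitarymx, upper_hessenberg 1 Q2 &
          Q = castmx (addnC k n, addnC k n) (block_mx Q1 0 0 Q2)];
  rep_T : Tk \in unitmx /\ upper_triangular Tk;
  rep_X : L *m castmx (addnC k n, erefl k) (col_mx Tk 0) = P^t* *m hX;
  rep_U : L *m Q *m Rs = P^t* *m hU *m P;
  rep_Z : Z = Rs *m P^t* *m hY;
  rep_A : As = L *m (Q + castmx (addnC k n, erefl k) (col_mx Tk 0) *m Z^t*) *m Rs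
}.

(* 0-based index k + i in a matrix of size n + k *)
Definition trail (n k : nat) (i : 'I_n) : 'I_(n + k) :=
  cast_ord (addnC k n) (rshift k i).

(* Main.v *)
(* Partition L as [L11 L12; L21 L22] with row blocks n, k and column blocks
   k, n, and let R21 be the n x n lower left block of R. The trailing rows of
   L^H A^ = (Q + T Z^H) R read L12^H A1 = Q2 R21, where A1 is the leading block
   of the iterate, Q2 the trailing block of Q, and L12 (lower) and R21 (upper)
   are triangular. Comparing entries, conj(l_jj) a_ji = q_ji r_ii for j = i + 1.
   Complementary minors of a unitary matrix have equal modulus and the last
   rows of L T = P^H X^ give L21 Tk = -I, so |det L12| = 1 / |det Tk| = K and
   |det R21| = K |det A|. The diagonal entries of L12 and R21 have modulus at
   most 1, hence modulus at least K and K |det A|, uniformly in s. *)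

Require Import Defs.
From mathcomp Require Import all_boot all_order all_algebra.
From mathcomp Require Import complex mxtens.
From mathcomp Require Import boolp classical_sets reals topology normedtype.
Import Order.TTheory GRing.Theory Num.Theory numFieldNormedType.Exports.

Set Implicit Arguments.
Unset Strict Implicit.
Unset Printing Implicit Defensive.

Local Open Scope classical_set_scope.
Local Open Scope ring_scope.
Local Open Scope complex_scope.
Local Open Scope sesquilinear_scope.

(** * Unitary matrices, triangular determinants and singular values *)

Lemma unitarymx_norm_le1 (C : numClosedFieldType) m n (M : 'M[C]_(m, n)) i j :
  M \is unitarymx -> `|M i j| <= 1.
Proof.
move=> /unitarymxP/matrixP/(_ i i); rewrite !mxE eqxx => M1.
rewrite -(@expr_le1 _ 2) // -[leRHS]M1 (bigD1 j) //= !mxE -normCK lerDl.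
by apply: sumr_ge0 => l _; rewrite !mxE -normCK exprn_ge0.
Qed.

Lemma unitarymx_norm_det (C : numClosedFieldType) n (M : 'M[C]_n) :
  M \is unitarymx -> `|\det M| = 1.
Proof.
move=> /unitarymxP/(congr1 determinant).
rewrite det_mulmx det_map_mx det_tr det1 -normCK => /eqP.
by rewrite pexpr_eq1 // => /eqP.
Qed.

(** Right multiplication by the block matrix with rows (I, Vdl^H) and (0, Vdr^H) makes the unitary
    matrix lower block triangular with diagonal blocks [Vul] and I; take determinants. *)
Lemma unitary_block_norm_det (C : numClosedFieldType) m n
    (Vul : 'M[C]_m) Vur Vdl (Vdr : 'M[C]_n) :
  block_mx Vul Vur Vdl Vdr \is unitarymx -> `|\det Vul| = `|\det Vdr|.
Proof.
move=> Vu; move: (Vu) => /unitarymxP.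
rewrite tr_block_mx map_block_mx mulmx_block scalar_mx_block.
move=> /eq_block_mx[_ ur _ dr].
have : block_mx Vul Vur Vdl Vdr *m block_mx 1%:M (Vdl^t*) 0 (Vdr^t*)
   = block_mx Vul 0 Vdl 1%:M.
  by rewrite mulmx_block !mulmx1 !mulmx0 !addr0 ur dr.
move=> /(congr1 (fun M => `|\det M|)).
rewrite det_mulmx det_ublock det_lblock !det1 mul1r mulr1 !normrM.
by rewrite (unitarymx_norm_det Vu) mul1r det_map_mx det_tr norm_conjC => ->.
Qed.

(** Serves as a lower bound for one diagonal entry: the other factors of the determinant have
    modulus at most 1. *)
Lemma norm_det_trig_le (C : numClosedFieldType) n (T : 'M[C]_n) i :
  is_trig_mx T -> (forall j, `|T j j| <= 1) -> `|\det T| <= `|T i i|.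
Proof.
move=> /det_trig-> T1; rewrite normr_prod (bigD1 i) //= ler_piMr //.
rewrite -[leRHS](@big1_eq _ _ *%R _ (index_enum 'I_n) (fun j => j != i)).
by apply: ler_prod => j _; rewrite normr_ge0 T1.
Qed.

(** The squared product is the product of the eigenvalues of X^H X, which is det (T^H T). *)
Lemma prod_sigma (R : realType) m k (X : 'M[R[i]]_(m, k)) (T : 'M[R[i]]_k) :
  X^t* *m X = T^t* *m T -> (\prod_(l < k) sigma X l)%:C = `|\det T|.
Proof.
move=> XT; rewrite /sigma -(big_mkord xpredT (fun l => (singular_values X)`_l)).
have szs : size (singular_values X) = k.
  by rewrite size_sort size_map -cardT card_ord.
have -> : \prod_(0 <= l < k) (singular_values X)`_l
    = \prod_(x <- singular_values X) x by rewrite [RHS](big_nth 0) szs.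
rewrite (perm_big _ (permEl (perm_sort _ _))) /=.
rewrite big_map big_enum /=.
set M := X^t* *m X; set S := spectralmx M; set d := spectral_diag M.
have Su : S \is unitarymx := spectral_unitarymx M.
have SM : M = S^t* *m diag_mx d *m S.
  rewrite -invmx_unitary //; apply/orthomx_spectralP/normalmxP.
  by rewrite /M trmx_mul map_mxM trmxCK.
(* The eigenvalues are the diagonal of a Gram matrix, hence real and nonnegative, so [complex.Re]
   and [Num.sqrt] lose nothing. *)
have dE : diag_mx d = (X *m S^t*)^t* *m (X *m S^t*).
  rewrite trmx_mul map_mxM trmxCK mulmxA -[_ *m X]mulmxA -/M SM.
  rewrite !mulmxA (unitarymxP Su) mul1mx -mulmxA (unitarymxP Su) mulmx1 //.
have d_ge0 i : 0 <= d 0 i.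
  have /matrixP/(_ i i) := dE; rewrite !mxE eqxx mulr1n => ->.
  by apply: sumr_ge0 => l _; rewrite !mxE mulrC -normCK exprn_ge0.
have detd : \prod_i d 0 i = `|\det T| ^+ 2.
  have := congr1 determinant SM; rewrite /M XT !det_mulmx !det_map_mx !det_tr.
  rewrite det_diag mulrAC [X in _ = X * _]mulrC -!normCK [in LHS]mulrC -normCK.
  by rewrite (unitarymx_norm_det Su) expr1n mul1r.
have ReC i : (complex.Re (d 0 i))%:C = d 0 i.
  by apply/RRe_real/ger0_real.
apply/eqP; rewrite -(@eqrXn2 _ 2) //; last first.
  by rewrite lecR; apply: prodr_ge0 => i _; apply: sqrtr_ge0.
rewrite -detd -rmorphXn -prodrXl rmorph_prod /=; apply/eqP/eq_bigr => i _.
by rewrite sqr_sqrtr ?ReC // -lecR ReC.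
Qed.

(** * Blocks of the factors of one iterate *)

Section Representation.
Variables (R : realType) (n k : nat).
Variables (hU : 'M[R[i]]_(n + k)) (hX hY : 'M[R[i]]_(n + k, k)).
Variables (P : 'M[R[i]]_(n + k)) (Tk : 'M[R[i]]_k).
Variables (L Q Rs : 'M[R[i]]_(n + k)) (Z : 'M[R[i]]_(n + k, k)).
Variable As : 'M[R[i]]_(n + k).
Hypothesis rep : represents hU hX hY P Tk L Q Rs Z As.

(* L partitioned as (n + k) x (k + n), Rs as (k + n) x (n + k). *)
Let Lc : 'M[R[i]]_(n + k, k + n) := castmx (erefl _, esym (addnC k n)) L.
Let Rc : 'M[R[i]]_(k + n, n + k) := castmx (esym (addnC k n), erefl _) Rs.

Definition rep_L12 : 'M[R[i]]_n := ursubmx Lc.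
Definition rep_R21 : 'M[R[i]]_n := dlsubmx Rc.

Lemma rep_L12E (p j : 'I_n) : rep_L12 p j = L (lshift k p) (trail k j).
Proof.
by rewrite !mxE castmxE; congr (L _ _); apply: val_inj.
Qed.

Lemma rep_R21E (q i : 'I_n) : rep_R21 q i = Rs (trail k q) (lshift k i).
Proof.
by rewrite !mxE castmxE; congr (Rs _ _); apply: val_inj.
Qed.

Lemma rep_L12_trig : is_trig_mx rep_L12.
Proof.
apply/is_trig_mxP => p j ltpj; rewrite rep_L12E.
by case: (rep_L rep) => _ [-> //] /=; rewrite addnC ltn_add2l.
Qed.

Lemma rep_R21_trig : upper_triangular rep_R21.
Proof.
apply/is_trig_mxP => i q ltiq; rewrite mxE rep_R21E.
by case: (rep_R rep) => _ [-> //] /=; rewrite addnC ltn_add2l.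
Qed.

Lemma rep_L12_le1 p j : `|rep_L12 p j| <= 1.
Proof. by rewrite rep_L12E unitarymx_norm_le1 //; case: (rep_L rep). Qed.

Lemma rep_R21_le1 q i : `|rep_R21 q i| <= 1.
Proof. by rewrite rep_R21E unitarymx_norm_le1 //; case: (rep_R rep). Qed.

(** The type of [Lc] is not square, so [mulmx1C] is applied to [L] and both products are carried
    through the cast. *)
Lemma rep_L_blocks_unitary : Lc *m Lc^t* = 1%:M /\ Lc^t* *m Lc = 1%:M.
Proof.
have [/unitarymxP Lu _] := rep_L rep; have Lu' := mulmx1C Lu.
rewrite /Lc; move: (esym _) => e; move: e Lu Lu'.
by move: (k + n)%N => m e; case: m / e; rewrite castmx_id.
Qed.

Lemma rep_norm_det_L12 (hX1 : 'M_(n, k)) :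
  P^t* *m hX = col_mx hX1 (- 1%:M) -> `|\det rep_L12| * `|\det Tk| = 1.
Proof.
(* Exchanging the column blocks of [Lc] keeps it unitary and makes L12 and L21 its diagonal
   blocks. *)
have V : block_mx (ursubmx Lc) (ulsubmx Lc) (drsubmx Lc) (dlsubmx Lc)
    \is unitarymx.
  apply/unitarymxP; rewrite -(proj1 rep_L_blocks_unitary) -[Lc in RHS]submxK.
  rewrite !tr_block_mx !map_block_mx !mulmx_block.
  by congr block_mx; rewrite addrC.
rewrite (unitary_block_norm_det V) -normrM -det_mulmx -(rep_X rep) => LT.
have : Lc *m col_mx Tk 0 = col_mx hX1 (- 1%:M).
  rewrite -LT /Lc mulmx_cast castmx_id.
  by congr (castmx (_, _) _ *m _); apply: eq_irrelevance.
rewrite -{1}[Lc]submxK mul_block_col !mulmx0 !addr0 => /eq_col_mx[_ ->].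
by rewrite -[- 1%:M]scaleN1r detZ det1 mulr1 normrX normrN1 expr1n.
Qed.

(** In the lower left block of L^H As, the zero rows of [As] remove L22; on the other side T Z^H
    reaches only the first k rows and [Q] is block diagonal. *)
Lemma rep_trailing (A1 : 'M_n) B : As = block_mx A1 B 0 0 ->
  exists Q2 : 'M_n, [/\ Q2 \is unitarymx, upper_hessenberg 1 Q2,
    forall j i, Q (trail k j) (trail k i) = Q2 j i &
    rep_L12^t* *m A1 = Q2 *m rep_R21].
Proof.
move=> AsE; have [_ [Q1 [Q2 [_ Q2u Q2H QE]]]] := rep_Q rep.
exists Q2; split=> // [j i|].
  rewrite QE castmxE -[RHS](block_mxEdr Q1 0 0 Q2).
  by congr (block_mx _ _ _ _ _ _); apply: val_inj.
have : As = Lc *m (block_mx Q1 0 0 Q2 +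
    col_mx Tk 0 *m (castmx (esym (addnC k n), erefl _) Z)^t*) *m Rc.
  rewrite (rep_A rep) QE /Lc /Rc; move: (addnC k n) => e.
  move: (block_mx _ _ _ _) (col_mx _ _) => /=.
  move: L Rs Z; case: _ / e => L' R' Z' B' T'; by rewrite !castmx_id.
move: (castmx _ Z) => Z'.
move=> /(congr1 (fun M => dlsubmx (Lc^t* *m M))).
rewrite !mulmxA (proj2 rep_L_blocks_unitary) mul1mx AsE.
rewrite -{1}[Lc]submxK -{1}[Rc]submxK -[Z']vsubmxK.
rewrite tr_block_mx map_block_mx tr_col_mx map_row_mx mul_col_row !mul0mx.
rewrite add_block_mx !mulmx_block !mulmx0 !addr0 mul0mx add0r.
by rewrite !block_mxKdl add0r.
Qed.

End Representation.

(* coord_continuous is limited to numFieldTypes, hence does not cover R[i]^o. *)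
Lemma mx_entry_continuous (T : topologicalType) m n i j :
  continuous (fun M : 'M[T]_(m, n) => M i j).
Proof.
move=> M B MB.
(* A neighborhood of a matrix is given by neighborhoods of its entries; only the entry (i, j) is
   constrained. *)
exists (fun i' j' => if (i' == i) && (j' == j) then B else setT) => [i' j'|N MN].
  by case: ifP => [/andP[/eqP-> /eqP->] //|_]; apply: filterT.
by have := MN i j; rewrite !eqxx.
Qed.

(** * Subdiagonal entries of the iterate and of [Q] *)

(** In the entry (j, i) of either product the triangular factor kills the indices on one side and
    the Hessenberg factor those on the other, leaving p = j on the left and p = i on the right. *)
Lemma hessenberg_subdiag (C : numClosedFieldType) n (L A Q T : 'M[C]_n)
    (i j : 'I_n) :
  is_trig_mx L -> upper_hessenberg 1 A -> upper_hessenberg 1 Q ->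
  upper_triangular T -> L^t* *m A = Q *m T -> j = i.+1 :> nat ->
  (L j j)^* * A j i = Q j i * T i i.
Proof.
move=> /is_trig_mxP Ltrig Ahess Qhess /is_trig_mxP Ttrig LAQT ji.
transitivity ((L^t* *m A) j i); last rewrite LAQT.
  rewrite mxE (bigD1 j) //= big1 ?addr0 => [|p pj]; rewrite !mxE //.
  have [ltpj|] := ltnP p j; first by rewrite Ltrig // rmorph0 mul0r.
  rewrite leq_eqVlt eq_sym val_eqE (negPf pj) /= => ltjp.
  by rewrite Ahess ?mulr0 // addn1 -ji.
rewrite mxE (bigD1 i) //= big1 ?addr0 // => p pi.
have [ltip|] := ltnP i p.
  by have := Ttrig i p ltip; rewrite mxE => ->; rewrite mulr0.
rewrite leq_eqVlt val_eqE (negPf pi) /= => ltpi.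
by rewrite Qhess ?mul0r // addn1 ji ltnS.
Qed.

(** The first bound gives the tolerance test and the second the limit. Each estimates one triangular
    diagonal entry from below by a determinant and the other from above by 1. *)
Lemma rep_subdiag_bounds (R : realType) n k hU hX hY P Tk L Q Rs Z As
    (rep : @represents R n k hU hX hY P Tk L Q Rs Z As) hX1 A1 B (i j : 'I_n) :
  P^t* *m hX = col_mx hX1 (- 1%:M) -> As = block_mx A1 B 0 0 ->
  upper_hessenberg 1 A1 -> j = i.+1 :> nat ->
  let K := `|\det Tk|^-1 in let q := Q (trail k j) (trail k i) in
  `|A1 j i| * K <= `|q| /\ `|q| * (`|\det A1| * K) <= `|A1 j i|.
Proof.
move=> hXE AsE A1hess ji K q.
have [Q2 [Q2u Q2hess QE LAQR]] := rep_trailing rep AsE.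
have detL : `|\det (rep_L12 L)| = K 
  by rewrite /K -(mulr1_eq (rep_norm_det_L12 rep hXE)) invrK.
have detR : `|\det (rep_R21 Rs)| = `|\det A1| * K.
  have := congr1 (fun M => `|\det M|) LAQR.
  rewrite !det_mulmx !normrM det_map_mx det_tr norm_conjC detL.
  by rewrite (unitarymx_norm_det Q2u) mul1r mulrC => <-.
have Kl : K <= `|rep_L12 L j j|.
  rewrite -detL; apply: (norm_det_trig_le _ (rep_L12_trig rep)).
  by move=> p; exact: (rep_L12_le1 rep).
have Kr : `|\det A1| * K <= `|rep_R21 Rs i i|.
  have -> : rep_R21 Rs i i = (rep_R21 Rs)^T i i by rewrite [RHS]mxE.
  rewrite -detR -det_tr.
  apply: (norm_det_trig_le _ (rep_R21_trig rep)).
  by move=> p; rewrite [X in `|X|]mxE; exact: (rep_R21_le1 rep).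
have := congr1 Num.norm (hessenberg_subdiag (rep_L12_trig rep) A1hess Q2hess
  (rep_R21_trig rep) LAQR ji).
rewrite -QE -/q !normrM norm_conjC => lar; split.
  rewrite mulrC; apply: le_trans (ler_wpM2r (normr_ge0 _) Kl) _.
  by rewrite lar ler_piMr //; exact: (rep_R21_le1 rep).
apply: le_trans (ler_wpM2l (normr_ge0 _) Kr) _.
by rewrite -lar ler_piMl //; exact: (rep_L12_le1 rep).
Qed.

Theorem lemma4 (R : realType) (n k : nat)
    (A U : 'M[R[i]]_n) (X Y QY : 'M[R[i]]_(n, k)) (RY : 'M[R[i]]_k)
    (hA : A = U + X *m Y^t*)
    (hAunit : A \in unitmx)
    (hAhess : proper_upper_hessenberg 1 A)
    (hU : U \is unitarymx)
    (hX : \rank X = k) (hY : \rank Y = k)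
    (hQRY : economy_qr Y QY RY)
    (As P : nat -> 'M[R[i]]_(n + k))
    (hqr : qr_iteration (embedA U X QY RY) As P)
    (hP : forall s, exists P1 : 'M[R[i]]_n, P s = block_mx P1 0 0 1%:M)
    (hhess : forall s, upper_hessenberg 1 (As s))
    (hcvg : cvg_to_upper_triangular As)
    (Tk : 'M[R[i]]_k) (L Q Rs : nat -> 'M[R[i]]_(n + k))
    (Z : nat -> 'M[R[i]]_(n + k, k))
    (hrep : forall s, represents (embedU U QY) (embedX U X QY RY) (embedY QY)
                        (P s) Tk (L s) (Q s) (Rs s) (Z s) (As s)) :
  let K : R := (\prod_(l < k) sigma (embedX U X QY RY) l)^-1 in
  forall i j : 'I_n, j = i.+1 :> nat ->
    ((Q s (trail k j) (trail k i) : R[i]^o) @[s --> \oo] --> (0 : R[i]^o)) /\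
    (forall (tau : R) (s : nat), 0 < tau ->
       `|Q s (trail k j) (trail k i)| < (tau * K)%:C ->
       `|ulsubmx (As s) j i| < tau%:C).
Proof.
move=> K i j ji.
(* [Tk] does not depend on s, so s = 0 suffices: [P 0] and [L 0] are unitary, hence [Tk] and the
   embedded X have the same Gram matrix. *)
have KE : K%:C = `|\det Tk|^-1.
  rewrite /K fmorphV; congr (_^-1); apply: prod_sigma.
  have [[/unitarymxP/mulmx1C Lu _] _ _ [_ _] LT _ _ _] := hrep 0%N.
  have [Pu _] := qr_iterationE hqr 0%N.
  set hX' := embedX _ _ _ _ in LT *.
  have -> : hX'^t* *m hX' = ((P 0%N)^t* *m hX')^t* *m ((P 0%N)^t* *m hX').
    rewrite trmx_mul map_mxM trmxCK mulmxA -[_ *m _ *m (P 0%N)^t*]mulmxA.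
    by rewrite (unitarymxP Pu) mulmx1.
  rewrite -LT trmx_mul map_mxM mulmxA -[_ *m _ *m L 0%N]mulmxA Lu mulmx1.
  case: _ / (addnC k n); rewrite castmx_id tr_col_mx map_row_mx mul_row_col.
  by rewrite mulmx0 addr0.
have K_gt0 : 0 < K%:C.
  rewrite KE invr_gt0 normr_gt0 -unitfE -unitmxE.
  by case: (rep_T (hrep 0%N)).
have detA_gt0 : 0 < `|\det A| by rewrite normr_gt0 -unitfE -unitmxE.
have bounds s : `|ulsubmx (As s) j i| * K%:C <= `|Q s (trail k j) (trail k i)| /\
    `|Q s (trail k j) (trail k i)| * (`|\det A| * K%:C) <= `|ulsubmx (As s) j i|.
  have [P1 PE] := hP s; have [Pu AsE] := qr_iterationE hqr s.
  have P1u : P1^t* *m P1 = 1%:M.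
    move: Pu => /unitarymxP/mulmx1C; rewrite PE tr_block_mx map_block_mx.
    rewrite mulmx_block scalar_mx_block => /eq_block_mx[+ _ _ _].
    by rewrite !trmx0 !map_mx0 mulmx0 addr0.
  have PtE : (P s)^t* = block_mx (P1^t*) 0 0 1%:M.
    by rewrite PE tr_block_mx map_block_mx !trmx0 !map_mx0 trmx1 map_mx1.
  move: AsE; rewrite (embedAE U X hQRY) -hA PtE PE !mulmx_block.
  rewrite !(mulmx0, mul0mx, addr0, add0r) mulmx1 => AsE.
  have A1E : ulsubmx (As s) = P1^t* *m A *m P1 by rewrite AsE block_mxKul.
  (* Unitary similarity preserves the determinant, so the bounds are uniform in s. *)
  have detA1 : \det A = \det (ulsubmx (As s)).
    by rewrite A1E !det_mulmx mulrAC -det_mulmx P1u det1 mul1r.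
  rewrite KE detA1; apply: (rep_subdiag_bounds (hrep s) _ _ _ ji).
  - by rewrite PtE /embedX mul_block_col mul0mx addr0 mul0mx add0r mul1mx.
  - by rewrite A1E; exact: AsE.
  - by move=> p q pq; rewrite !mxE hhess.
split=> [|tau s tau_gt0 qlt]; last first.
  rewrite -(ltr_pM2r K_gt0); apply: le_lt_trans (proj1 (bounds s)) _.
  by rewrite -rmorphM.
have [S Striu AsS] := hcvg.
have aS0 : (ulsubmx (As s) j i : R[i]^o) @[s --> \oo] --> (0 : R[i]^o).
  have -> : 0 = S (lshift k j) (lshift k i).
    have /is_trig_mxP/(_ (lshift k i) (lshift k j)) := Striu.
    by rewrite mxE => -> //=; rewrite ji.
  rewrite [X in X @ _](_ : _ = fun s =>
    (As s : 'M[R[i]^o]_(n + k)) (lshift k j) (lshift k i)); last first.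
    by apply/funext => s; rewrite !mxE.
  pose f (M : 'M[R[i]^o]_(n + k)) := M (lshift k j) (lshift k i).
  apply: (@cvg_comp _ _ _ (As : nat -> 'M[R[i]^o]_(n + k)) f _ _ _ AsS).
  exact: mx_entry_continuous.
(* Nonsingularity of [A] makes this constant positive, so the tolerance [e] can be rescaled by
   it. *)
have c_gt0 : 0 < `|\det A| * K%:C by rewrite mulr_gt0.
apply/cvgr0Pnorm_lt => e e_gt0.
have /cvgr0Pnorm_lt/(_ (e * (`|\det A| * K%:C))) := aS0.
rewrite mulr_gt0 // => /(_ isT); apply: filterS => s.
move=> /(le_lt_trans (proj2 (bounds s))).
by rewrite ltr_pM2r.
Qed.
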